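(* Let $S\subset\mathbb{R}^n$ be a finite set whose convex hull $\operatorname{conv}(S)$ has non-empty interior. For $x\in\operatorname{conv}(S)$ let $$\phi(x)=\max\Big\{\sum_{s\in S}p_s\ln\frac1{p_s}:\ \sum_{s\in S}p_s=1,\ \sum_{s\in S}s\,p_s=x,\ p_s\ge0\ \text{for all } s\in S\Big\}.$$ Then $\phi$ is a strictly concave continuous function on $\operatorname{conv}(S)$. Let $\mathcal{A}\subset\mathbb{R}^n$ be an affine subspace intersecting the interior of $\operatorname{conv}(S)$. Then $\phi$ attains its maximum value on $\mathcal{A}\cap\operatorname{conv}(S)$ at a unique point $z$ in the interior of $\operatorname{conv}(S)$; there is a unique probability distribution $\mu$ on $S$ with entropy $\phi(z)$ and expectation in $\mathcal{A}$; and $\mu\{s\}=e^{-\phi(z)}$ for all $s\in S\cap\mathcal{A}$. In particular $|S\cap\mathcal{A}|=e^{\phi(z)}\mu(S\cap\mathcal{A})$.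
   Context: The entropy of a probability distribution $(p_s)_{s\in S}$ on $S$ is $\sum_{s\in S}p_s\ln(1/p_s)$ with $0\ln(1/0)=0$; its expectation is $\sum_s s\,p_s$. *)

(* Defs.v *)
From mathcomp Require Import all_boot all_order all_algebra finmap.
From mathcomp Require Import all_classical all_reals all_analysis.
Import Order.TTheory GRing.Theory Num.Theory numFieldNormedType.Exports.

Set Implicit Arguments.
Unset Strict Implicit.
Unset Printing Implicit Defensive.

Local Open Scope classical_set_scope.
Local Open Scope ring_scope.

Definition conv_hull (R : realType) (n : nat) (S : set 'rV[R]_n) :
    set 'rV[R]_n :=
  smallest (@convex_set R 'rV[R]_n) S.

Definition affine_subspace (R : realType) (n : nat) (A : set 'rV[R]_n) : Prop :=
  exists (a : 'rV[R]_n) (W : {vspace 'rV[R]_n}),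
    A = [set a + w | w in [set w | w \in W]].

Definition strictly_concave (R : realType) (n : nat) (D : set 'rV[R]_n)
    (f : 'rV[R]_n -> R) : Prop :=
  forall (x y : 'rV[R]_n) (t : R), D x -> D y -> x != y -> 0 < t -> t < 1 ->
    t * f x + (1 - t) * f y < f (t *: x + (1 - t) *: y).

(* The set of all points of D at which f attains its maximum over D; empty if
   the maximum is not attained. *)
Definition argmax (R : realType) (T : Type) (f : T -> R) (D : set T) : set T :=
  [set x | D x /\ forall y, D y -> f y <= f x].

Definition prob_distr (R : realType) (T : finType) (p : {ffun T -> R}) : Prop :=
  (forall s, 0 <= p s) /\ \sum_s p s = 1.

(* A term with p s = 0 vanishes, in accordance with 0 ln (1/0) = 0. *)
Definition entropy (R : realType) (T : finType) (p : {ffun T -> R}) : R :=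
  \sum_s p s * ln (1 / p s).

Definition distr_expectation (R : realType) (n : nat) (S : {fset 'rV[R]_n})
    (p : {ffun S -> R}) : 'rV[R]_n :=
  \sum_(s : S) p s *: val s.

Definition distr_at (R : realType) (n : nat) (S : {fset 'rV[R]_n})
    (x : 'rV[R]_n) : set {ffun S -> R} :=
  [set p | prob_distr p /\ distr_expectation p = x].
Arguments distr_at {R n} S x _.

(* The value is a junk value when no distribution on S has expectation x.
   That the supremum is attained on the convex hull of S is not part of the
   definition. *)
Definition max_entropy (R : realType) (n : nat) (S : {fset 'rV[R]_n})
    (x : 'rV[R]_n) : R :=
  sup [set entropy p | p in distr_at S x].

(* Main.v *)
(** By Gibbs' inequality [H(p) <= sum_s p_s ln (1 / r_s)], with equality only
    for [r = p], the entropy [H] is strictly concave; hence so is [phi], and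
    the maximizer [mu] of [H] over the distributions with expectation in a
    closed convex set is unique.

    Upper semicontinuity of [phi] is compactness of the simplex. For lower
    semicontinuity at [x], with optimal [p], a conic Caratheodory bound writes
    [y - x = sum_s c_s (s - x)] with [c >= 0] and [sum_s c_s = O(|y - x|)], so
    [y] is the expectation of the distribution [(1 - sum_s c_s) p + c], which
    tends to [p].

    For the last part, optimality of [mu] against [t q + (1 - t) mu], combined
    with Gibbs' inequality, gives [sum_s q_s ln (1 / mu_s) <= H(mu)] for each
    admissible [q]. Some admissible [q] has full support, so [mu] has full
    support and [z] is interior. Taking for [q] the point mass at a point [s]
    of [A], and then [(1 + t) mu - t delta_s], gives [- ln mu_s = H(mu)]. *)

Require Import Defs.
From mathcomp Require Import all_boot all_order all_algebra finmap.
From mathcomp Require Import all_classical all_reals all_analysis.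
From mathcomp Require Import ring lra.
Import Order.TTheory GRing.Theory Num.Theory numFieldNormedType.Exports.

Set Implicit Arguments.
Unset Strict Implicit.
Unset Printing Implicit Defensive.

Local Open Scope classical_set_scope.
Local Open Scope ring_scope.

(** * Entropy and Gibbs' inequality *)

Section Entropy.
Context {R : realType}.
Implicit Types u v : R.

Lemma ln_inv1 u : ln (1 / u) = - ln u :> R.
Proof.
rewrite div1r; have [u0|u0] := leP u 0; last by rewrite lnV.
by rewrite !ln0 ?oppr0 ?invr_le0.
Qed.

(** For positive [u] and [v] this is [1 + x < expR x] at [x = ln v - ln u], multiplied by [u]. The
    condition at [v = 0] excludes the default value [ln 0 = 0], where the true right-hand side would
    be infinite. *)
Lemma mul_ln_lt u v : 0 <= u -> 0 <= v -> (v = 0 -> u = 0) -> u != v ->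
  u * - ln u < u * - ln v + (v - u).
Proof.
move=> u0 v0 uv neq.
have [u00|un0] := eqVneq u 0.
  by rewrite u00 !mul0r add0r subr0 lt_neqAle v0 andbT -u00.
have up : 0 < u by rewrite lt_neqAle eq_sym un0.
have vp : 0 < v.
  rewrite lt_neqAle eq_sym v0 andbT; apply/eqP => /uv; exact/eqP.
have x0 : ln v - ln u != 0.
  by rewrite subr_eq0; apply: contra neq => /eqP /ln_inj ->.
have := expR_gt1Dx x0; rewrite -ln_div// lnK ?posrE ?divr_gt0//.
rewrite ln_div// ltr_pdivlMr//; nra.
Qed.

(** Linear in [p] for fixed [r], which all the optimality arguments exploit. A term with [r s = 0]
    is 0 instead of infinite, hence the support condition in Gibbs' inequality. *)
Definition cross_entropy (T : finType) (p r : {ffun T -> R}) : R :=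
  \sum_s p s * - ln (r s).

Lemma entropyE (T : finType) (p : {ffun T -> R}) :
  entropy p = cross_entropy p p.
Proof. by apply: eq_bigr => s _; rewrite ln_inv1. Qed.

Lemma prob_distr_le1 {T : finType} {p : {ffun T -> R}} s : prob_distr p -> p s <= 1.
Proof.
move=> [p0 <-]; rewrite (bigD1 s)//= lerDl sumr_ge0 // => i _; exact: p0.
Qed.

Section gibbs.
Context {T : finType} (p r : {ffun T -> R}).
Hypotheses (pp : prob_distr p) (pr : prob_distr r).
Hypothesis supp : forall s, r s = 0 -> p s = 0.

(* The difference of the two sides is summed termwise; the corrections
   [r s - p s] add up to zero. *)
Lemma gibbs_lt : p <> r -> entropy p < cross_entropy p r.
Proof.
move=> neq; rewrite entropyE.
have -> : cross_entropy p r = \sum_s (p s * - ln (r s) + (r s - p s)).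
  by rewrite big_split /= sumrB pr.2 pp.2 subrr addr0.
have [s ps] : exists s, p s != r s.
  by apply/existsP; rewrite -negb_forall; apply/forallP => h; apply: neq;
    apply/ffunP => s; apply/eqP.
rewrite /cross_entropy (bigD1 s)//= [ltRHS](bigD1 s)//=.
apply: ltr_leD; first by apply: mul_ln_lt; [exact: pp.1|exact: pr.1|exact: supp|].
apply: ler_sum => i _; have [->|ne] := eqVneq (p i) (r i); first by rewrite subrr addr0.
by apply/ltW/mul_ln_lt => //; [exact: pp.1|exact: pr.1|exact: supp].
Qed.

Lemma gibbs : entropy p <= cross_entropy p r.
Proof.
have [->|/gibbs_lt/ltW//] := pselect (p = r); by rewrite entropyE.
Qed.

End gibbs.

Definition mix (T : finType) (t : R) (p q : {ffun T -> R}) : {ffun T -> R} :=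
  [ffun s => t * p s + (1 - t) * q s].

Section mix.
Context {T : finType}.
Implicit Types (p q r : {ffun T -> R}) (t : R).

Lemma sum_mix t p q : prob_distr p -> prob_distr q -> \sum_s mix t p q s = 1.
Proof.
move=> pp pq; under eq_bigr do rewrite ffunE.
by rewrite big_split -!mulr_sumr pp.2 pq.2 /= !mulr1 addrC subrK.
Qed.

Lemma prob_mix t p q : 0 <= t -> t <= 1 -> prob_distr p -> prob_distr q ->
  prob_distr (mix t p q).
Proof.
move=> t0 t1 pp pq; split; last exact: sum_mix.
by move=> s; rewrite ffunE addr_ge0 // mulr_ge0 ?subr_ge0 ?pp.1 ?pq.1.
Qed.

Lemma cross_mixl t p q r :
  cross_entropy (mix t p q) r = t * cross_entropy p r + (1 - t) * cross_entropy q r.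
Proof.
rewrite !mulr_sumr -big_split; apply: eq_bigr => s _.
by rewrite ffunE mulrDl !mulrA.
Qed.

Lemma mix_eq0 t p q s : 0 < t -> t < 1 -> prob_distr p -> prob_distr q ->
  mix t p q s = 0 -> p s = 0 /\ q s = 0.
Proof.
move=> t0 t1 pp pq; rewrite ffunE; move: (pp.1 s) (pq.1 s) => ? ? h; split; nra.
Qed.

(** The entropy of the mixture is its cross entropy against itself. Linearity splits it into the
    cross entropies of [p] and [q] against the mixture, and Gibbs applies to each, strictly to the
    first. *)
Lemma entropy_mix_lt t p q : 0 < t -> t < 1 -> prob_distr p -> prob_distr q ->
  p <> q -> t * entropy p + (1 - t) * entropy q < entropy (mix t p q).
Proof.
move=> t0 t1 pp pq neq.
have pr : prob_distr (mix t p q) by apply: prob_mix => //; exact: ltW.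
rewrite [ltRHS]entropyE cross_mixl; apply: ltr_leD.
  rewrite ltr_pM2l// gibbs_lt// => [s|] .
    by move=> /mix_eq0 [].
  move=> e; apply: neq; apply/ffunP => s.
  by move/ffunP/(_ s): e; rewrite ffunE => ?; nra.
rewrite ler_pM2l ?subr_gt0// gibbs// => s.
by move=> /mix_eq0 [].
Qed.

End mix.

(** * Entropy maximizers over a convex set of distributions *)

Section entropy_maximizer.
Context {T : finType} (K : set {ffun T -> R}) (mu : {ffun T -> R}).
Hypothesis K_prob : forall p, K p -> prob_distr p.
Hypothesis K_mix : forall t p q, 0 <= t -> t <= 1 -> K p -> K q -> K (mix t p q).
Hypothesis mu_max : argmax (@entropy R T) K mu.

Lemma argmax_entropy_unique p : K p -> entropy mu <= entropy p -> p = mu.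
Proof.
move=> Kp le; apply: contrapT => neq; have [Kmu mx] := mu_max.
have h0 : 0 < 2^-1 :> R by rewrite invr_gt0.
have h1 : 2^-1 < 1 :> R by rewrite invf_lt1// ltr1n.
have := entropy_mix_lt h0 h1 (K_prob Kp) (K_prob Kmu) neq.
have := mx _ (K_mix (ltW h0) (ltW h1) Kp Kmu); move: (mx _ Kp); lra.
Qed.

(** A first-order optimality condition without derivatives: split the entropy of the mixture by
    linearity, bound the part of [mu] below by Gibbs, and divide by [t]. *)
Lemma cross_mix_le q t : K q -> 0 < t -> t < 1 ->
  cross_entropy q (mix t q mu) <= entropy mu.
Proof.
move=> Kq t0 t1; have [Kmu mx] := mu_max.
have Kr : K (mix t q mu) by apply: K_mix => //; exact: ltW.
have := mx _ Kr; rewrite [X in X <= _]entropyE cross_mixl.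
have : entropy mu <= cross_entropy mu (mix t q mu).
  apply: gibbs; [exact: K_prob|exact: K_prob|].
  by move=> s /mix_eq0 []//; exact: K_prob.
nra.
Qed.

(** The entropy has infinite slope where a coordinate vanishes: if [mu s = 0], the bound of
    [cross_mix_le] fails for small [t]. *)
Lemma argmax_entropy_gt0 q s : K q -> 0 < q s -> 0 < mu s.
Proof.
move=> Kq qs0; have [Kmu mx] := mu_max.
rewrite lt_neqAle (K_prob Kmu).1 andbT; apply/eqP => mus0.
(* Here [q s * - ln (t * q s)] alone exceeds [entropy mu]. *)
pose t := expR (- ((`|entropy mu| + 1) / q s)).
have t0 : 0 < t by exact: expR_gt0.
have N0 : 0 < (`|entropy mu| + 1) / q s by rewrite divr_gt0// ltr_wpDl.
have t1 : t < 1 by rewrite -expR0 ltr_expR oppr_lt0.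
have Kr : K (mix t q mu) by apply: K_mix => //; exact: ltW.
have := cross_mix_le Kq t0 t1; rewrite /cross_entropy (bigD1 s)//= => le.
have h1 : 0 <= \sum_(i | i != s) q i * - ln (mix t q mu i).
  apply: sumr_ge0 => i _; rewrite mulr_ge0 ?(K_prob Kq).1// oppr_ge0 ln_le0//.
  exact/prob_distr_le1/K_prob.
have h2 : ln (mix t q mu s) <= - ((`|entropy mu| + 1) / q s).
  rewrite ffunE -mus0 mulr0 addr0 lnM ?posrE// expRK gerDl ln_le0//.
  exact/prob_distr_le1/K_prob.
have : `|entropy mu| + 1 <= q s * - ln (mix t q mu s).
  by rewrite mulrC -ler_pdivrMr// lerNr.
have := ler_norm (entropy mu); lra.
Qed.

(** The limit of [cross_mix_le] as [t] tends to 0. By [ln (1 + x) <= x], replacing the mixture by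
    [mu] costs at most [t * M]. *)
Lemma cross_argmax_le q : (forall s, 0 < mu s) -> K q ->
  cross_entropy q mu <= entropy mu.
Proof.
move=> mu0 Kq; have [Kmu mx] := mu_max.
pose M := \sum_s q s * `|(q s - mu s) / mu s|.
have M0 : 0 <= M by apply: sumr_ge0 => s _; rewrite mulr_ge0// (K_prob Kq).1.
have le t : 0 < t -> t < 1 -> cross_entropy q mu <= entropy mu + t * M.
  move=> t0 t1; apply: le_trans (lerD (cross_mix_le Kq t0 t1) (lexx _)).
  rewrite mulr_sumr -big_split; apply: ler_sum => s _ /=.
  rewrite mulrCA -mulrDr ler_wpM2l ?(K_prob Kq).1// lerNl opprD opprK.
  have rs0 : 0 < mix t q mu s.
    rewrite ffunE ltr_wpDl// ?mulr_ge0 ?(K_prob Kq).1 1?ltW// ?mulr_gt0//.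
    by rewrite subr_gt0.
  rewrite lerBlDr -lerBlDl -ln_div ?posrE//.
  have := divr_gt0 rs0 (mu0 s).
  have -> : mix t q mu s / mu s = 1 + t * ((q s - mu s) / mu s).
    by rewrite ffunE; field; exact: lt0r_neq0.
  rewrite -ltrBlDl sub0r => /le_ln1Dx /le_trans; apply.
  by rewrite ler_pM2l// ler_norm.
apply/ler_addgt0Pl => e e0.
(* Small enough that [t * M <= e]; [M + 1] avoids a division by zero. *)
pose t := Num.min 2^-1 (e / (M + 1)).
have M1 : 0 < M + 1 by rewrite ltr_wpDl.
have t0 : 0 < t by rewrite lt_min invr_gt0 ltr0n /= divr_gt0.
have t1 : t < 1 by rewrite gt_min invf_lt1// ltr1n.
apply: le_trans (le t t0 t1) _; rewrite addrC lerD2r.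
have : t <= e / (M + 1) by rewrite ge_min lexx orbT.
rewrite ler_pdivlMr//; nra.
Qed.

End entropy_maximizer.
End Entropy.

(** * Continuity and compactness *)

Section Topology.
Context {R : realType}.

(* Continuity at 0 and below holds because [ln] is 0 on nonpositive reals. *)
Lemma xlnx_continuous : continuous (fun u : R => u * - ln u).
Proof.
move=> u; have [u0|u0|->] := ltgtP u 0.
- rewrite /continuous_at ln0 ?ltW// oppr0 mulr0.
  apply: cvg_near_cst; near=> x; rewrite ln0 ?oppr0 ?mulr0//.
  by apply: ltW; near: x; exact: lt_nbhsl.
- apply: cvgM => //; apply: cvgN; exact: continuous_ln.
- rewrite /continuous_at mul0r; apply: norm_cvg0.
  (* With [s] the square root of [x], [x * - ln x = 2 * s * (s * - ln s)], and the last factor is at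
     most 1 because [ln s^-1 < s^-1]. *)
  apply: (@squeeze_cvgr _ _ _ _ (fun=> 0) (fun x : R => 2 * Num.sqrt x)); last first.
  + rewrite -[X in _ --> X](mulr0 2) -[X in _ * X]sqrtr0.
    by apply: cvgM; [exact: cvg_cst|exact: sqrt_continuous].
  + exact: cvg_cst.
  near=> x; rewrite normr_ge0 /=.
  have [x0|x0] := leP x 0; first by rewrite ln0// oppr0 mulr0 normr0 mulr_ge0 ?sqrtr_ge0.
  have x1 : x < 1 by near: x; exact: lt_nbhsl.
  have s0 : 0 < Num.sqrt x by rewrite sqrtr_gt0.
  have xE : x = Num.sqrt x ^+ 2 by rewrite sqr_sqrtr// ltW.
  rewrite ger0_norm ?mulr_ge0 ?(ltW x0)// ?oppr_ge0 ?ln_le0 ?(ltW x1)//.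
  have : ln (Num.sqrt x)^-1 < (Num.sqrt x)^-1 by rewrite ln_sublinear// invr_gt0.
  rewrite lnV// ltrNl => h.
  rewrite {1 2}xE lnXn// -mulr_natl.
  have : Num.sqrt x * - ln (Num.sqrt x) <= 1.
    by rewrite mulrC -ler_pdivlMr// div1r lerNl ltW.
  nra.
Unshelve. all: by end_near. Qed.

Lemma continuous_sum (X : topologicalType) (V : normedModType R) (I : finType)
    (f : I -> X -> V) :
  (forall i, continuous (f i)) -> continuous (fun x => \sum_i f i x).
Proof.
by move=> cf x; apply: cvg_big => [|i _]; [exact: add_continuous|exact: cf].
Qed.

Lemma entropy_cvg (T : finType) (I : Type) (F : set_system I) (f : I -> {ffun T -> R})
    (p : {ffun T -> R}) : Filter F ->
  (forall s, f i s @[i --> F] --> p s) -> entropy (f i) @[i --> F] --> entropy p.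
Proof.
move=> FF fp; rewrite entropyE /cross_entropy.
under eq_fun do rewrite entropyE /cross_entropy.
apply: cvg_big => [|s _]; first exact: add_continuous.
exact: (cvg_comp (fun i => f i s) (fun u => u * - ln u) (fp s) (@xlnx_continuous _)).
Qed.

(* [{ffun T -> R}] carries no topology in the library; row vectors do. *)
Definition of_row (T : finType) (u : 'rV[R]_#|T|) : {ffun T -> R} :=
  [ffun s => u 0 (enum_rank s)].

Section rows.
Context {T : finType}.

Lemma of_row_surj (p : {ffun T -> R}) : exists u, of_row u = p.
Proof.
exists (\row_i p (enum_val i)); apply/ffunP => s.
by rewrite ffunE mxE enum_rankK.
Qed.

Lemma of_row_continuous s : continuous (fun u : 'rV[R]_#|T| => of_row u s).
Proof.
move=> u; rewrite /continuous_at ffunE; under eq_fun do rewrite ffunE.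
exact: coord_continuous.
Qed.

Lemma simplex_compact : compact [set u : 'rV[R]_#|T| | prob_distr (of_row u)].
Proof.
pose B := [set u : 'rV[R]_#|T| | forall i, `[0, 1 : R]%classic (u ord0 i)].
have cB : compact B.
  by apply: (rV_compact (A := fun=> `[0, 1 : R]%classic)) => _;
  exact: segment_compact.
apply: (subclosed_compact _ cB); last first.
  move=> u pu i /=; rewrite in_itv /=.
  have := pu.1 (enum_val i); have := prob_distr_le1 (enum_val i) pu.
  by rewrite ffunE enum_valK => -> ->.
rewrite (_ : [set _ | _] =
  \bigcap_(s in [set: T]) ((fun u : 'rV[R]_#|T| => of_row u s) @^-1` [set x | 0 <= x])
  `&` ((fun u : 'rV[R]_#|T| => \sum_s of_row u s) @^-1` [set 1])); last first.
  by apply/seteqP; split => u [h1 h2]; split => // s; [move=> _|]; exact: h1.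
apply: closedI.
  apply: closed_bigI => s _; apply: preimage_closed; last exact: closed_ge.
  by move=> u _; exact: of_row_continuous.
apply: preimage_closed; last exact: closed_eq.
move=> u _; apply: (@continuous_sum _ _ _ (fun s u => of_row u s)) => s.
exact: of_row_continuous.
Qed.

Lemma entropy_row_continuous : continuous (fun u : 'rV[R]_#|T| => entropy (of_row u)).
Proof. by move=> u; apply: (@entropy_cvg _ _ (nbhs u)) => s; exact: of_row_continuous. Qed.

Lemma argmax_entropy_exists (K : set {ffun T -> R}) :
  K !=set0 -> K `<=` @prob_distr R T -> closed (@of_row T @^-1` K) ->
  argmax (@entropy R T) K !=set0.
Proof.
move=> [p Kp] Kprob cK; have [u up] := of_row_surj p.
have cpt : compact (@of_row T @^-1` K).
  by apply: (subclosed_compact cK simplex_compact) => v /Kprob.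
have [||w wK wmax] := @compact_EVT_max _ R (fun u => entropy (of_row u)) _ _ cpt.
- by exists u; rewrite /= up.
- exact/continuous_subspaceT/entropy_row_continuous.
exists (of_row w); split; first by move: wK; rewrite inE.
move=> q Kq; have [v vq] := of_row_surj q.
by rewrite -vq wmax // inE /= vq.
Qed.

End rows.

Section expectation.
Context {n : nat} (S : {fset 'rV[R]_n}).

Lemma expectation_row_continuous :
  continuous (fun u : 'rV[R]_#|{: S}| => distr_expectation (of_row u)).
Proof.
apply: (@continuous_sum _ _ _ (fun s u => of_row u s *: val s)) => s u.
apply: (@cvgZr_tmp _ _ _ (nbhs u)); exact: of_row_continuous.
Qed.

(** For a singleton [A] this unfolds to [distr_at], so one existence proof serves both a point and
    an affine subspace. *)
Definition distr_on (A : set 'rV[R]_n) : set {ffun S -> R} :=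
  [set p | prob_distr p /\ A (distr_expectation p)].

Lemma argmax_distr_on_exists A : closed A -> distr_on A !=set0 ->
  argmax (@entropy R S) (distr_on A) !=set0.
Proof.
move=> cA ne; apply: argmax_entropy_exists => //; first by move=> p [].
rewrite (_ : _ @^-1` _ = [set u | prob_distr (of_row u)] `&`
  (fun u : 'rV[R]_#|{: S}| => distr_expectation (of_row u)) @^-1` A) //.
apply: closedI.
  by apply: compact_closed; [exact: norm_hausdorff|exact: simplex_compact].
by apply: preimage_closed => // u _; exact: expectation_row_continuous.
Qed.

Lemma argmax_distr_at_exists x : distr_at S x !=set0 ->
  argmax (@entropy R S) (distr_at S x) !=set0.
Proof.
apply: (@argmax_distr_on_exists [set x]).
by apply: accessible_closed_set1; apply: hausdorff_accessible; exact: norm_hausdorff.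
Qed.

Lemma max_entropyE x p : argmax (@entropy R S) (distr_at S x) p ->
  max_entropy S x = entropy p.
Proof.
move=> [xp pmax]; apply/eqP; rewrite eq_le; apply/andP; split.
  apply: ge_sup; first by exists (entropy p), p.
  by move=> _ [q xq <-]; exact: pmax.
by apply: ub_le_sup; [exists (entropy p) => _ [q xq <-]; exact: pmax|exists p].
Qed.

Lemma entropy_le_max (p : {ffun S -> R}) : prob_distr p ->
  entropy p <= max_entropy S (distr_expectation p).
Proof.
move=> pp; have ne : distr_at S (distr_expectation p) !=set0 by exists p.
have [q mq] := argmax_distr_at_exists ne.
by rewrite (max_entropyE mq); apply: mq.2.
Qed.

(** The distributions of entropy at least [max_entropy S x + e] form a compact set, so their
    expectations form a closed set [EL]. It misses [x], hence a neighbourhood of [x]. *)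
Lemma max_entropy_usc x e : distr_at S x !=set0 -> 0 < e ->
  \forall y \near x, distr_at S y !=set0 -> max_entropy S y < max_entropy S x + e.
Proof.
move=> xne e0.
pose L := [set u : 'rV[R]_#|{: S}| | prob_distr (of_row u)] `&`
  [set u | max_entropy S x + e <= entropy (of_row u)].
pose EL := [set @distr_expectation R n S (of_row u) | u in L].
have cL : compact L.
  apply: compact_closedI; first exact: simplex_compact.
  apply: (@preimage_closed _ _ (fun u : 'rV[R]_#|{: S}| => entropy (of_row u))
    [set z | max_entropy S x + e <= z]); last exact: closed_ge.
  by move=> u _; exact: entropy_row_continuous.
have cEL : closed EL.
  apply: compact_closed; first exact: norm_hausdorff.
  apply: continuous_compact => //.
  exact/continuous_subspaceT/expectation_row_continuous.
have nx : (~` EL) x.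
  move=> [u [pu le] Eu]; have := entropy_le_max pu; rewrite Eu; move: le => /=; lra.
have := open_nbhs_nbhs (conj (closed_openC cEL) nx); apply: filterS => y ny yne.
have [q mq] := argmax_distr_at_exists yne.
rewrite (max_entropyE mq) ltNge; apply/negP => le.
have [u uq] := of_row_surj q.
by apply: ny; exists u; rewrite ?uq; [split => /=; rewrite uq; [exact: mq.1.1|]|exact: mq.1.2].
Qed.

End expectation.
End Topology.

Arguments distr_on {R n} S A _.

(** * Convex hulls and cones *)

Section ConvexHull.
Context {R : realType}.

Lemma convex_setP {V : lmodType R} (D : set V) : convex_set D <->
  forall x y t, 0 <= t -> t <= 1 -> D x -> D y -> D (t *: x + (1 - t) *: y).
Proof.
split => [cD x y t t0 t1 Dx Dy|cD x y t]; last first.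
  by rewrite !inE => Dx Dy; apply: cD.
by have := cD x y (Itv01 t0 t1); rewrite !inE; exact.
Qed.

Lemma convex_hull_convex n (A : set 'rV[R]_n) : convex_set (conv_hull A).
Proof.
apply/convex_setP => x y t t0 t1 Ax Ay D [cD AD].
by move/convex_setP: (cD); apply => //; [apply: Ax|apply: Ay].
Qed.

(** The weights are normalized in the conclusion so that the induction hypothesis applies to the
    tail of the list. *)
Lemma convex_comb {V : lmodType R} (D : set V) (I : Type) (r : seq I)
    (a : I -> R) (v : I -> V) :
  convex_set D -> (forall i, 0 <= a i) -> (forall i, D (v i)) ->
  0 < \sum_(i <- r) a i ->
  D ((\sum_(i <- r) a i)^-1 *: \sum_(i <- r) a i *: v i).
Proof.
move=> /convex_setP cD a0 Dv; elim: r => [|i r ih]; first by rewrite big_nil ltxx.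
rewrite !big_cons; set s := \sum_(j <- r) a j; set w := \sum_(j <- r) _ => sp.
have s0 : 0 <= s by apply: sumr_ge0.
(* A tail of total weight 0 cannot be normalized, but all its terms vanish. *)
have [se0|sn0] := eqVneq s 0.
  have -> : w = 0.
    move: se0; rewrite /s /w; elim: (r) => [|j r' ih']; first by rewrite !big_nil.
    rewrite !big_cons => /eqP; rewrite paddr_eq0 ?sumr_ge0// => /andP[/eqP -> /eqP /ih' ->].
    by rewrite scale0r addr0.
  have ai : a i != 0 by move: sp; rewrite se0 addr0 => /lt0r_neq0.
  by rewrite se0 !addr0 scalerA mulVf // scale1r.
have sp' : 0 < s by rewrite lt_neqAle eq_sym sn0.
have tn : a i + s != 0 by exact: lt0r_neq0.
have := cD (v i) (s^-1 *: w) (a i / (a i + s)).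
rewrite (_ : 1 - a i / (a i + s) = s / (a i + s)); last by field.
rewrite [(s / _) *: _]scalerA (_ : s / (a i + s) / s = (a i + s)^-1);
  last by field; apply/andP.
rewrite scalerDr scalerA (mulrC (_^-1)); apply => //; last exact: ih.
  by rewrite divr_ge0// ltW.
by rewrite ler_pdivrMr// mul1r lerDl.
Qed.

Lemma expectation_mix n (S : {fset 'rV[R]_n}) t (p q : {ffun S -> R}) :
  distr_expectation (mix t p q) =
  t *: distr_expectation p + (1 - t) *: distr_expectation q.
Proof.
rewrite /distr_expectation !scaler_sumr -big_split; apply: eq_bigr => s _.
by rewrite ffunE scalerDl !scalerA.
Qed.

Definition point_mass (T : finType) (s : T) : {ffun T -> R} := [ffun u => (u == s)%:R].

Lemma prob_point_mass (T : finType) (s : T) : prob_distr (point_mass s).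
Proof.
split=> [u|]; first by rewrite ffunE ler0n.
by rewrite (bigD1 s)//= ffunE eqxx big1 ?addr0// => u /negbTE us; rewrite ffunE us.
Qed.

Lemma expectation_point_mass n (S : {fset 'rV[R]_n}) (s : S) :
  distr_expectation (point_mass s) = val s.
Proof.
rewrite /distr_expectation (bigD1 s)//= ffunE eqxx scale1r big1 ?addr0//.
by move=> u /negbTE us; rewrite ffunE us scale0r.
Qed.

(** The expectations of distributions form a convex set by [mix], which contains [S] by point
    masses; conversely each is a convex combination of points of [S]. *)
Lemma conv_hullP n (S : {fset 'rV[R]_n}) x :
  conv_hull [set` S] x <-> distr_at S x !=set0.
Proof.
split; last first.
  move=> [p [pp <-]].
  have := @convex_comb _ (conv_hull [set` S]) S (index_enum S) p val
    (@convex_hull_convex _ _) pp.1.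
  rewrite pp.2 invr1 scale1r; apply => // s; apply: sub_gen_smallest; exact: valP.
apply: (@smallest_sub _ _ _ [set x | distr_at S x !=set0]).
  apply/convex_setP => y z t t0 t1 [p [pp <-]] [q [pq <-]].
  by exists (mix t p q); split; [exact: prob_mix|exact: expectation_mix].
move=> s sS; exists (point_mass [` sS]%fset); split; first exact: prob_point_mass.
exact: expectation_point_mass.
Qed.

End ConvexHull.

(** * A conic Caratheodory bound *)

Section ConeBound.
Context {R : realType} {n : nat} {T : finType}.

(* Induction on the allowed support [A]. Either [\sum_i p i *: v i] stays away
   from 0 for [p] in the simplex supported on [A], which gives [K] directly; or
   it vanishes at some [w], and subtracting a multiple of [w] removes one index
   from the support of [c]. The second summand of [f] penalizes [p] outside [A]. *)
Lemma cone_bound_supp (v : T -> 'rV[R]_n) k (A : {set T}) : (#|A| <= k)%N ->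
  exists K : R, forall c : T -> R,
    (forall i, 0 <= c i) -> (forall i, i \notin A -> c i = 0) ->
  exists c' : T -> R, [/\ forall i, 0 <= c' i, \sum_i c' i *: v i = \sum_i c i *: v i &
    \sum_i c' i <= K * `|\sum_i c i *: v i|].
Proof.
elim: k A => [|k ih] A Ak.
  exists 0 => c c0 cA; exists c; split => //.
  rewrite mul0r big1 // => i _; apply: cA.
  by move: Ak; rewrite leqn0 cards_eq0 => /eqP ->; rewrite inE.
have [A0|[i0 i0A]] := set_0Vmem A.
  by apply: ih; rewrite A0 cards0.
pose f (p : {ffun T -> R}) := `|\sum_i p i *: v i| + \sum_i if i \notin A then p i else 0.
have fE p : f p = `|\sum_i p i *: v i| + \sum_(i | i \notin A) p i.
  by congr (_ + _); rewrite [RHS]big_mkcond.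
have [w [pw wmin]] : exists w, prob_distr w /\ forall p, prob_distr p -> f w <= f p.
  have [u up] := of_row_surj (point_mass i0 : {ffun T -> R}).
  have [||w wK wmin] := @compact_EVT_min _ R (fun u => f (of_row u)) _ _ (@simplex_compact R T).
  - by exists u; rewrite /= up; exact: prob_point_mass.
  - apply: continuous_subspaceT => z.
    have c1 : continuous (fun u : 'rV[R]_#|T| => \sum_i of_row u i *: v i).
      apply: (@continuous_sum _ _ _ _ (fun s u => of_row u s *: v s)) => s z'.
      by apply: (@cvgZr_tmp _ _ _ (nbhs z')); exact: of_row_continuous.
    have c2 : continuous (fun u : 'rV[R]_#|T| =>
        \sum_i if i \notin A then of_row u i else 0 : R).
      apply: (@continuous_sum _ _ _ _
        (fun s u => if s \notin A then of_row u s else 0 : R)) => s.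
      by case: (s \notin A); [exact: of_row_continuous|exact: cst_continuous].
    exact: (cvgD (cvg_norm (c1 z)) (c2 z)).
  exists (of_row w); split; first by move: wK; rewrite inE.
  by move=> q pq; have [z zq] := of_row_surj q; rewrite -zq wmin// inE /= zq.
have pos_supp : 0 <= \sum_(i | i \notin A) w i by apply: sumr_ge0 => i _; exact: pw.1.
have f0 : 0 <= f w by rewrite fE addr_ge0.
have [fw0|fwn0] := eqVneq (f w) 0; last first.
  have fwp : 0 < f w by rewrite lt_neqAle eq_sym fwn0.
  exists (f w)^-1 => c c0 cA; exists c; split => //.
  have [s0|sn0] := eqVneq (\sum_i c i) 0.
    by rewrite s0 mulr_ge0// invr_ge0.
  have sp : 0 < \sum_i c i by rewrite lt_neqAle eq_sym sn0 sumr_ge0.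
  (* By homogeneity it suffices to compare [f w] with the normalized [c], whose penalty is zero. *)
  pose p : {ffun T -> R} := [ffun i => (\sum_i c i)^-1 * c i].
  have pp : prob_distr p.
    split => [i|]; first by rewrite ffunE mulr_ge0// invr_ge0 ltW.
    by under eq_bigr do rewrite ffunE; rewrite -mulr_sumr mulVf.
  have := wmin p pp; rewrite [f p]fE [X in _ + X]big1; last first.
    by move=> i /cA ci; rewrite ffunE ci mulr0.
  rewrite addr0; under eq_bigr do rewrite ffunE -scalerA.
  rewrite -scaler_sumr normrZ gtr0_norm ?invr_gt0//.
  by rewrite ler_pdivlMl// ler_pdivlMl// mulrC.
have wA i : i \notin A -> w i = 0.
  move=> iA; apply: le_anti; rewrite pw.1 andbT.
  have : w i <= \sum_(i | i \notin A) w i.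
    by rewrite (bigD1 i)//= lerDl sumr_ge0// => j _; exact: pw.1.
  have : \sum_(i | i \notin A) w i <= f w by rewrite fE lerDr.
  by rewrite fw0 => le0 /le_trans; apply.
have wv : \sum_i w i *: v i = 0.
  apply/eqP; rewrite -normr_eq0 eq_le normr_ge0 andbT.
  by rewrite -fw0 fE lerDl.
(* The index to be removed depends on [c], so a constant is fixed for every index and their absolute
   values are added. *)
have /choice[K HK] : forall i, exists K : R, i \in A -> forall c : T -> R,
    (forall i, 0 <= c i) -> (forall j, j \notin A :\ i -> c j = 0) ->
  exists c' : T -> R, [/\ forall i, 0 <= c' i, \sum_i c' i *: v i = \sum_i c i *: v i &
    \sum_i c' i <= K * `|\sum_i c i *: v i|].
  move=> i; have [iA|_] := boolP (i \in A); last by exists 0.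
  have [|K HK] := ih (A :\ i); last by exists K.
  by move: Ak; rewrite (cardsD1 i) iA.
exists (\sum_i `|K i|) => c c0 cA.
have [j0 j0p] : exists j, 0 < w j.
  apply: contrapT => h; have := pw.2; rewrite big1 => [/eqP|j _].
    by rewrite eq_sym oner_eq0.
  apply: le_anti; rewrite pw.1 andbT leNgt; apply/negP => ?; apply: h; by exists j.
(* The least ratio is the largest multiple of [w] that can be subtracted from [c] keeping all
   coefficients nonnegative; the coefficient at [i] becomes 0. *)
have [i wi imin] := @arg_minP _ _ T j0 (fun j => 0 < w j) (fun j => c j / w j) j0p.
pose t := c i / w i.
have t0 : 0 <= t by rewrite divr_ge0// ltW.
have iA : i \in A by apply/negPn/negP => /wA wi0; move: wi; rewrite wi0 ltxx.
have cE : \sum_j (c j - t * w j) *: v j = \sum_j c j *: v j.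
  under eq_bigr do rewrite scalerBl -scalerA.
  by rewrite sumrB -scaler_sumr wv scaler0 subr0.
have [||c' [c'0 c'v c'le]] := HK i iA (fun j => c j - t * w j).
- move=> j; rewrite subr_ge0.
  have [wj0|wjn0] := eqVneq (w j) 0; first by rewrite wj0 mulr0.
  have wjp : 0 < w j by rewrite lt_neqAle eq_sym wjn0 pw.1.
  by rewrite -ler_pdivlMr// imin.
- move=> j; rewrite !inE negb_and negbK => /orP[/eqP ->|jA].
    by rewrite /t divfK ?subrr// lt0r_neq0.
  by rewrite cA// wA// mulr0 subr0.
exists c'; split => //; first by rewrite c'v cE.
apply: (le_trans c'le); rewrite cE ler_wpM2r//.
apply: (le_trans (ler_norm _)).
by rewrite (bigD1 i)//= lerDl sumr_ge0.
Qed.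

Lemma cone_bound (v : T -> 'rV[R]_n) :
  exists K : R, forall c : T -> R, (forall i, 0 <= c i) ->
  exists c' : T -> R, [/\ forall i, 0 <= c' i, \sum_i c' i *: v i = \sum_i c i *: v i &
    \sum_i c' i <= K * `|\sum_i c i *: v i|].
Proof.
have [K HK] := cone_bound_supp v (leqnn #|[set: T]%SET|).
by exists K => c c0; apply: HK => // i; rewrite inE.
Qed.

End ConeBound.

(** * The maximal entropy function *)

Section MaxEntropy.
Context {R : realType} {n : nat}.
Implicit Types (S : {fset 'rV[R]_n}) (A : set 'rV[R]_n).

Lemma max_entropy_lsc S x e : distr_at S x !=set0 -> 0 < e ->
  \forall y \near x, distr_at S y !=set0 -> max_entropy S x - e < max_entropy S y.
Proof.
move=> xne e0; have [p mp] := argmax_distr_at_exists xne.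
rewrite (max_entropyE mp); have [[pp Ep] _] := mp.
have [K HK] := cone_bound (fun s : S => val s - x).
have K0 y : 0 <= `|K| * `|y - x| by rewrite mulr_ge0.
(* Choosing [r] as a total function of [y] allows limits along [nbhs x]; where no suitable
   distribution is required, [p] serves as filler. *)
have /choice[r Hr] : forall y, exists r : {ffun S -> R},
    (forall s, `|r s - p s| <= `|K| * `|y - x|) /\
    (distr_at S y !=set0 -> `|K| * `|y - x| <= 1 -> distr_at S y r).
  move=> y; have [[[q [pq Eq]] K1]|h] :=
    pselect (distr_at S y !=set0 /\ `|K| * `|y - x| <= 1); last first.
    exists p; split => [s|? ?]; first by rewrite subrr normr0.
    by exfalso; apply: h.
  (* Any [q] with expectation [y] puts [y - x] in the cone of the vectors [s - x]; [c] represents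
     the same vector with small total weight. *)
  have [c [c0 cv cle]] := HK q pq.1.
  have qE : \sum_i q i *: (val i - x) = y - x.
    under eq_bigr do rewrite scalerBr.
    by rewrite sumrB -scaler_suml pq.2 scale1r -Eq.
  rewrite qE in cv cle; set k := \sum_i c i in cle.
  have kle : k <= `|K| * `|y - x|.
    by apply: (le_trans cle); rewrite ler_wpM2r// ler_norm.
  have ck s : c s <= k by rewrite /k (bigD1 s)//= lerDl sumr_ge0.
  have k0 : 0 <= k by apply: sumr_ge0.
  exists [ffun s => (1 - k) * p s + c s]; split => [s|_ _].
    apply: le_trans kle; rewrite ffunE ler_norml.
    have := prob_distr_le1 s pp; have := pp.1 s; have := c0 s; have := ck s.
    by move=> *; apply/andP; split; nra.
  split; first split => [s|].
  - by rewrite ffunE addr_ge0// mulr_ge0 ?pp.1// subr_ge0 (le_trans kle).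
  - under eq_bigr do rewrite ffunE.
    by rewrite big_split -mulr_sumr /= pp.2 mulr1 subrK.
  - rewrite /distr_expectation; under eq_bigr do rewrite ffunE scalerDl -scalerA.
    rewrite big_split -scaler_sumr /= -[\sum_i p i *: _]/(distr_expectation p) Ep.
    have : \sum_i c i *: val i = y - x + k *: x.
      rewrite -cv; under [in RHS]eq_bigr do rewrite scalerBr.
      by rewrite sumrB -scaler_suml subrK.
    by move=> ->; rewrite scalerBl scale1r addrACA addNr addr0 addrC subrK.
have cvK : `|K| * `|y - x| @[y --> x] --> (0 : R).
  rewrite -(mulr0 `|K|).
  apply: (@cvgM _ _ (nbhs x) _ (fun=> `|K|) (fun y => `|y - x|)); first exact: cvg_cst.
  have := cvg_norm (@cvgB _ _ _ (nbhs x) _ id (fun=> x) x x cvg_id (cvg_cst x)).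
  rewrite subrr normr0; exact.
have cvr : entropy (r y) @[y --> x] --> entropy p.
  apply: (@entropy_cvg _ _ _ (nbhs x)) => s.
  rewrite -[p s]addr0.
  under eq_fun do rewrite -(subrK (p s) (r _ s)) addrC.
  apply: cvgD; first exact: cvg_cst.
  apply: norm_cvg0; apply: (squeeze_cvgr _ (cvg_cst _) cvK).
  by apply: nearW => y; rewrite normr_ge0 (Hr y).1.
have K1 : \forall y \near x, `|K| * `|y - x| <= 1.
  exact: (@cvgr_le _ _ (nbhs x) _ _ _ cvK _ ltr01).
have pe : entropy p - e < entropy p by rewrite ltrBlDr ltrDl.
have re : \forall y \near x, entropy p - e < entropy (r y).
  exact: (@cvgr_gt _ _ (nbhs x) _ _ _ cvr _ pe).
apply: filterS2 K1 re => y K1 re yne.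
have yr : distr_at S y (r y).
  exact: (Hr y).2.
apply: lt_le_trans (_ : entropy (r y) <= _); last first.
  by have [pr Er] := yr; rewrite -{2}Er; exact: entropy_le_max.
exact: re.
Qed.

Lemma max_entropy_continuous S :
  {within conv_hull [set` S], continuous (max_entropy S)}.
Proof.
rewrite continuous_subspace_in => x; rewrite inE => /conv_hullP xne.
apply/cvgrPdist_lt => e e0.
rewrite /prop_near1 -nbhs_subspace_in; last exact/conv_hullP.
rewrite /within /=; have := max_entropy_lsc xne e0; have := max_entropy_usc xne e0.
apply: filterS2 => y us ls /conv_hullP yne.
by rewrite ltr_norml /from_subspace;
  have := us yne; have := ls yne => ? ?; apply/andP; split; lra.
Qed.

Lemma max_entropy_strictly_concave S :
  strictly_concave (conv_hull [set` S]) (max_entropy S).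
Proof.
move=> x y t /conv_hullP/argmax_distr_at_exists[p mp].
move=> /conv_hullP/argmax_distr_at_exists[q mq] xy t0 t1.
rewrite (max_entropyE mp) (max_entropyE mq).
have [[[pp Ep] _] [[pq Eq] _]] := (mp, mq).
have pm : prob_distr (mix t p q) by apply: prob_mix => //; exact: ltW.
have := entropy_le_max pm; rewrite expectation_mix Ep Eq.
apply: lt_le_trans; apply: entropy_mix_lt => // pqE.
by move/eqP: xy; apply; rewrite -Ep -Eq pqE.
Qed.

Lemma linear_row_continuous m (f : {linear 'rV[R]_n -> 'rV[R]_m}) : continuous f.
Proof.
have -> : (f : _ -> _) = (fun u => \sum_j u 0 j *: f (delta_mx 0 j)).
  by apply/funext => u; rewrite {1}(row_sum_delta u) linear_sum;
    apply: eq_bigr => j _; rewrite linearZ.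
apply: (@continuous_sum _ _ _ _ (fun j (u : 'rV[R]_n) => u 0 j *: f (delta_mx 0 j))) => j u.
by apply: (@cvgZr_tmp _ _ _ (nbhs u)); exact: coord_continuous.
Qed.

Lemma affine_subspace_closed A : affine_subspace A -> closed A.
Proof.
(* The projection onto [W] fixes exactly the vectors of [W], so [f] vanishes exactly on the
   subspace. *)
move=> [a [W ->]]; pose f (y : 'rV[R]_n) := projv W (y - a) - (y - a).
rewrite (_ : [set _ | _ in _] = f @^-1` [set 0]).
  apply: preimage_closed; last first.
    by apply: accessible_closed_set1; apply: hausdorff_accessible; exact: norm_hausdorff.
  have cs : continuous (fun y : 'rV[R]_n => y - a).
    move=> y; exact: (@cvgB _ _ _ (nbhs y) _ id (fun=> a) y a cvg_id (cvg_cst a)).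
  have cp : continuous (fun y : 'rV[R]_n => projv W (y - a)).
    move=> y; have cW := @linear_row_continuous n (projv W).
    exact: (@continuous_comp _ _ _ (fun y : 'rV[R]_n => y - a) (projv W) y (cs y) (cW _)).
  move=> y _; exact: (@cvgB _ _ _ (nbhs y) _ _ _ _ _ (cp y) (cs y)).
apply/seteqP; split => y /=.
  by move=> [w wW <-]; rewrite /f addrAC subrr add0r projv_id// subrr.
move=> /eqP; rewrite /f subr_eq0 => /eqP fy.
by exists (y - a); [rewrite -fy memv_proj|rewrite addrC subrK].
Qed.

Lemma affine_subspace_comb A t x y : affine_subspace A -> A x -> A y ->
  A (t *: x + (1 - t) *: y).
Proof.
move=> [a [W ->]] [u uW <-] [w wW <-]; exists (t *: u + (1 - t) *: w).
  by rewrite /= memvD// memvZ.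
by rewrite !scalerDr addrACA -scalerDl [t + _]addrC subrK scale1r.
Qed.

(** * Interior points and full support *)

Lemma nbhs_ray (D : set 'rV[R]_n) (x w : 'rV[R]_n) :
  nbhs x D -> exists2 t : R, 0 < t & D (x + t *: w).
Proof.
move=> xD; have : x + t *: w @[t --> (0 : R)] --> x.
  have := @cvgD _ _ _ (nbhs (0 : R)) _ _ _ _ _ (cvg_cst x) (cvgZr_tmp (a := w) cvg_id).
  rewrite scale0r addr0; exact.
move=> /(_ _ xD) /nbhs_ballP[e /= e0 he].
exists (e / 2); first by rewrite divr_gt0.
apply: he; rewrite /ball /= sub0r normrN gtr0_norm ?divr_gt0//.
by rewrite ltr_pdivrMr// ltr_pMr// ltr1n.
Qed.

(** Moving from [x] slightly away from the mean of the uniform distribution [b] stays in the hull.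
    Then [x] lies between the new point and that mean, and the share of [b] makes every weight
    positive. *)
Lemma interior_full_support S x : (conv_hull [set` S])° x ->
  exists2 q, distr_at S x q & forall s, 0 < q s.
Proof.
move=> xC; have [p [pp _]] : distr_at S x !=set0.
  by apply/conv_hullP; exact: interior_subset.
have S0 : (0 < #|{: S}|)%N.
  rewrite lt0n; apply/eqP => /card0_eq S0.
  have := pp.2; rewrite big_pred0 => [/eqP|s]; last by have := S0 s.
  by rewrite eq_sym oner_eq0.
have S0' : 0 < #|{: S}|%:R :> R by rewrite ltr0n.
pose b : {ffun S -> R} := [ffun=> #|{: S}|%:R^-1].
have pb : prob_distr b.
  split => [s|]; first by rewrite ffunE invr_ge0 ltW.
  by under eq_bigr do rewrite ffunE;
    rewrite sumr_const -[RHS](divff (lt0r_neq0 S0')) [RHS]mulr_natl.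
have [t t0 /conv_hullP[q [pq Eq]]] := nbhs_ray (x - distr_expectation b) xC.
pose l := (1 + t)^-1.
have t1 : 0 < 1 + t by rewrite addr_gt0.
have l0 : 0 < l by rewrite invr_gt0.
have l1 : l < 1 by rewrite invf_lt1// ltrDl.
exists (mix l q b).
  split; first by apply: prob_mix => //; exact: ltW.
  rewrite expectation_mix Eq scalerDr scalerA scalerBr addrA.
  have -> : l * t = 1 - l by rewrite /l; field; exact: lt0r_neq0.
  by rewrite subrK -scalerDl [l + _]addrC subrK scale1r.
move=> s; rewrite !ffunE ltr_wpDl ?mulr_ge0 ?pq.1 1?ltW//.
by rewrite divr_gt0// subr_gt0.
Qed.

Lemma mix_extend (T : finType) (p q : {ffun T -> R}) : prob_distr p -> prob_distr q ->
  (forall s, 0 < p s) -> exists2 t, 0 < t & prob_distr (mix (1 + t) p q).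
Proof.
(* The product is a positive number below every [p s], so it can serve as [t]. *)
move=> pp pq p0; have t0 : 0 < \prod_s p s by apply: prodr_gt0 => s _.
exists (\prod_s p s) => //; split => [s|]; last exact: sum_mix.
have : \prod_s p s <= p s.
  rewrite (bigD1 s)//= ler_piMr ?pp.1// prodr_ile1// => i _.
  by rewrite pp.1 prob_distr_le1.
rewrite ffunE; move: t0; set t := \prod_s _.
have := prob_distr_le1 s pq; have := pq.1 s; have := p0 s; nra.
Qed.

(** Extending the segment from [x] beyond [z] gives a point [z'] of the hull. The homothety with
    centre [z'] taking [x] to [z] maps a neighbourhood of [x] in the hull onto one of [z]; [u] goes
    to [x + k *: (u - z)] under its inverse. *)
Lemma full_support_interior S (p : {ffun S -> R}) : (conv_hull [set` S])° !=set0 ->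
  prob_distr p -> (forall s, 0 < p s) -> (conv_hull [set` S])° (distr_expectation p).
Proof.
move=> [x xC] pp p0; set z := distr_expectation p.
have [q [pq Eq]] : distr_at S x !=set0.
  by apply/conv_hullP; exact: interior_subset.
have [t t0 pm] := mix_extend pp pq p0.
pose k := (1 + t) / t.
have t1 : 0 < 1 + t by rewrite addr_gt0.
have t1n := lt0r_neq0 t1; have tn := lt0r_neq0 t0.
have gx : x + k *: (u - z) @[u --> z] --> x.
  have cs := @cvgB _ _ _ (nbhs z) _ id (fun=> z) z z cvg_id (cvg_cst z).
  have := @cvgD _ _ _ (nbhs z) _ _ _ _ _ (cvg_cst x) (cvgZl_tmp (k := k) (cs _ _)).
  rewrite subrr scaler0 addr0; exact.
suff : \forall u \near z, conv_hull [set` S] u by [].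
move: (gx _ xC); apply: (@filterS _ (nbhs z)) => u /= Cu.
have := @convex_hull_convex R n [set` S] => /convex_setP.
move=> /(_ (distr_expectation (mix (1 + t) p q)) (x + k *: (u - z)) (1 + t)^-1).
have -> : (1 + t)^-1 *: distr_expectation (mix (1 + t) p q) +
  (1 - (1 + t)^-1) *: (x + k *: (u - z)) = u.
  rewrite expectation_mix -/z Eq; apply/rowP => j; rewrite !mxE /k; field.
  by rewrite tn t1n.
apply => //.
- by rewrite invr_ge0 ltW.
- by rewrite invf_le1// lerDl ltW.
- by apply/conv_hullP; eexists; split; [exact: pm|].
Qed.

End MaxEntropy.

Theorem theorem3p5 (R : realType) (n : nat) (S : {fset 'rV[R]_n})
    (phi := max_entropy S) (C := conv_hull [set` S]) :
  C° !=set0 ->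
  (forall x, C x ->
     exists2 p, argmax (@entropy R S) (distr_at S x) p & phi x = entropy p) /\
  strictly_concave C phi /\
  {within C, continuous phi} /\
  (forall A : set 'rV[R]_n, affine_subspace A -> A `&` C° !=set0 ->
     exists z : 'rV[R]_n,
       argmax phi (A `&` C) = [set z] /\
       C° z /\
       exists mu : {ffun S -> R},
         [set p : {ffun S -> R} |
            [/\ prob_distr p, entropy p = phi z & A (distr_expectation p)]] = [set mu] /\
         (forall s : S, A (val s) -> mu s = expR (- phi z)) /\
         #|` [fset s in S | s \in A]%fset|%:R
           = expR (phi z) * \sum_(s : S | val s \in A) mu s).
Proof.
move=> C0; split; first move=> x /conv_hullP/argmax_distr_at_exists[p mp].
  by exists p => //; exact: max_entropyE.
split; first exact: max_entropy_strictly_concave.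
split; first exact: max_entropy_continuous.
move=> A affA [x [Ax xC]].
have [q [pq Eq] q0] := interior_full_support xC.
have Kq : distr_on S A q by split => //; rewrite Eq.
(* Maximizing over all expectations in [A] at once yields [mu] first; [z] is then its
   expectation. *)
have [mu mmu] := argmax_distr_on_exists (affine_subspace_closed affA) (ex_intro _ q Kq).
have [[pmu Amu] mu_max] := mmu.
have K_prob p : distr_on S A p -> prob_distr p by case.
have K_mix t p r : 0 <= t -> t <= 1 -> distr_on S A p -> distr_on S A r ->
    distr_on S A (mix t p r).
  move=> t0 t1 [pp Ap] [pr Ar]; split; first exact: prob_mix.
  by rewrite expectation_mix; exact: affine_subspace_comb.
have uniq p : distr_on S A p -> entropy mu <= entropy p -> p = mu.
  exact: argmax_entropy_unique.
have mu0 s : 0 < mu s by apply: (argmax_entropy_gt0 K_prob K_mix mmu Kq).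
have mucross p : distr_on S A p -> cross_entropy p mu <= entropy mu.
  exact: cross_argmax_le.
set z := distr_expectation mu in Amu.
have phiz : phi z = entropy mu.
  apply: max_entropyE; split => // p [pp Ep]; apply: mu_max.
  by split => //; rewrite Ep.
have mus s : A (val s) -> mu s = expR (- phi z).
  move=> As; have Ks : distr_on S A (point_mass s).
    by split; [exact: prob_point_mass|rewrite expectation_point_mass].
  have crossE : cross_entropy (point_mass s) mu = - ln (mu s).
    rewrite /cross_entropy (bigD1 s)//= ffunE eqxx mul1r big1 ?addr0//.
    by move=> u /negbTE us; rewrite ffunE us mul0r.
  have [t t0 pt] := mix_extend pmu (prob_point_mass s) mu0.
  have Kt : distr_on S A (mix (1 + t) mu (point_mass s)).
    by split => //; rewrite expectation_mix; apply: affine_subspace_comb => //; exact: Ks.2.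
  (* The point mass gives [- ln (mu s) <= entropy mu]; the extension beyond [mu], where the point
     mass has weight [- t], gives the reverse. *)
  have := mucross _ Kt; have := mucross _ Ks.
  rewrite cross_mixl crossE -entropyE => h1 h2.
  have -> : phi z = - ln (mu s) by rewrite phiz; nra.
  by rewrite opprK lnK// posrE.
exists z; split.
  apply/seteqP; split => y /=.
    move=> [[Ay Cy] ymax].
    have /argmax_distr_at_exists[p mp] := (iffLR (conv_hullP _ _) Cy).
    have [[pp Ep] _] := mp.
    suff pE : p = mu by rewrite -Ep pE.
    (* An optimal [p] for a maximizer [y] has at least the entropy of [mu], so it equals [mu]. *)
    apply: uniq; first by split => //; rewrite Ep.
    rewrite -(max_entropyE mp) -phiz; apply: ymax; split => //.
    by apply/conv_hullP; exists mu.
  move=> ->; split; first by split => //; apply/conv_hullP; exists mu.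
  move=> w [Aw /conv_hullP/argmax_distr_at_exists[p mp]].
  have [[pp Ep] _] := mp.
  by rewrite phiz /phi (max_entropyE mp); apply: mu_max; split => //; rewrite Ep.
split; first exact: full_support_interior.
exists mu; split.
  apply/seteqP; split => p /=.
    by move=> [pp Hp Ap]; apply: uniq; [split|rewrite Hp phiz].
  by move=> ->; split.
split => //.
(* Each summand times [expR (phi z)] is 1, so the sum counts the points of [S] in [A]. *)
under eq_bigr => s /set_mem sA do rewrite (mus s sA).
rewrite card_fset_sum1 big_fset big_seq_fsetE natr_sum mulr_sumr.
by apply: eq_bigr => s _; rewrite -expRD subrr expR0.
Qed.
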